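(* Let $\mathsf A$ be the Cartan matrix of type $C_n$, with nodes labelled so that $\alpha_1$ is the long simple root and $\Lambda_n$ is the minuscule fundamental weight. Let $b\in B(\Lambda_n)$ and $\xi=\mathrm{wt}(b)$. Then the cyclotomic quiver Hecke algebra $R^{\Lambda_n}(\xi)$ is isomorphic to $\mathbf k$ (as a $\mathbf k$-algebra).
   Context: Setting. $\mathbf k$ is a field, $I=\{1,\dots,n\}$, and $\mathsf A=(a_{ij})$ is the Cartan matrix of type $C_n$ with Dynkin diagram the chain $1-2-\cdots-n$, double bond between $1$ and $2$ with arrow from $1$ to $2$ ($\alpha_1$ long, $a_{12}=-1$, $a_{21}=-2$, all other adjacent entries $-1$). Simple roots $\alpha_i$, coroots $h_i$, fundamental weights $\Lambda_i$, with $\langle h_i,\alpha_j\rangle=a_{ij}$, $\langle h_j,\Lambda_i\rangle=\delta_{ij}$; $(\alpha_i,\alpha_j)=\mathsf d_ia_{ij}$ with $\mathsf d_i$ relatively prime positive integers making this symmetric; $\mathsf Q_+=\sum_i\mathbb Z_{\ge0}\alpha_i$, $\mathrm{ht}(\sum k_i\alpha_i)=\sum k_i$. $B(\Lambda_n)$ is the crystal of the irreducible highest weight $U_q(\mathfrak g)$-module $V(\Lambda_n)$; it is identified with the Weyl group orbit $\mathsf W\cdot\Lambda_n$ (each element being its own weight), with $2n$ elements forming a single string whose successive arrows from the highest weight element are labelled $n,n-1,\dots,2,1,2,\dots,n$. Quiver Hecke algebra. Fix polynomials $Q_{i,j}(u,v)=(1-\delta_{i,j})\sum t_{i,j;p,q}u^pv^q\in\mathbf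 k[u,v]$, the sum over $(p,q)\in\mathbb Z_{\ge0}^2$ with $(\alpha_i,\alpha_i)p+(\alpha_j,\alpha_j)q=-2(\alpha_i,\alpha_j)$, where $t_{i,j;p,q}=t_{j,i;q,p}$ and $t_{i,j;-a_{ij},0}\in\mathbf k^\times$; assume $Q_{i,j}=1$ whenever $(\alpha_i,\alpha_j)=0$. For $\beta\in\mathsf Q_+$ with $\mathrm{ht}(\beta)=N$, let $I^\beta=\{\nu\in I^N\mid\sum_k\alpha_{\nu_k}=\beta\}$, with $\mathfrak S_N=\langle s_1,\dots,s_{N-1}\rangle$ acting by place permutation. $R(\beta)$ is the $\mathbf k$-algebra generated by $e(\nu)$ ($\nu\in I^\beta$), $x_k$ ($1\le k\le N$), $\tau_m$ ($1\le m\le N-1$) with relations: $e(\nu)e(\nu')=\delta_{\nu,\nu'}e(\nu)$, $\sum_\nu e(\nu)=1$; $x_kx_m=x_mx_k$, $x_ke(\nu)=e(\nu)x_k$; $\tau_me(\nu)=e(s_m\nu)\tau_m$; $\tau_k\tau_m=\tau_m\tau_k$ if $|k-m|>1$; $\tau_k^2e(\nu)=Q_{\nu_k,\nu_{k+1}}(x_k,x_{k+1})e(\nu)$; $(\tau_kx_m-x_{s_k(m)}\tau_k)e(\nu)$ equals $-e(\nu)$ if $m=k,\nu_k=\nu_{k+1}$, equals $e(\nu)$ if $m=k+1,\nu_k=\nu_{k+1}$, and $0$ otherwise; $(\tau_{k+1}\tau_k\tau_{k+1}-\tau_k\tau_{k+1}\tau_k)e(\nu)$ equals $\frac{Q_{\nu_k,\nu_{k+1}}(x_k,x_{k+1})-Q_{\nu_k,\nu_{k+1}}(x_{k+2},x_{k+1})}{x_k-x_{k+2}}e(\nu)$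 if $\nu_k=\nu_{k+2}$, and $0$ otherwise. For a dominant integral weight $\Lambda$, the cyclotomic quiver Hecke algebra is $R^\Lambda(\Lambda-\beta)=R(\beta)/I^\Lambda_\beta$, where $I^\Lambda_\beta$ is the two-sided ideal generated by $x_N^{\langle h_{\nu_N},\Lambda\rangle}e(\nu)$, $\nu\in I^\beta$. *)

(* Defs.v *)
From HB Require Import structures.
From mathcomp Require Import all_boot all_order perm all_algebra.
From mathcomp.classical Require Import boolp.
From mathcomp.multinomials Require Import monalg.

Set Implicit Arguments.
Unset Strict Implicit.
Unset Printing Implicit Defensive.

Import GRing.Theory Num.Theory.
Local Open Scope ring_scope.
Local Open Scope quotient_scope.

(** * Associative unital algebras over a field, possibly zero

    MathComp's [algType] requires [1 != 0], which is not available for an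
    arbitrary algebra given by generators and relations. The algebra structure
    is given by a ring morphism from [k] to the centre. *)

HB.mixin Record isPzAlgebra (k : fieldType) A of GRing.PzRing A := {
  alg_const : {rmorphism k -> A};
  alg_const_central : forall (c : k) (x : A), alg_const c * x = x * alg_const c
}.

#[short(type="pzAlgType")]
HB.structure Definition PzAlgebra (k : fieldType) :=
  {A of GRing.PzRing A & isPzAlgebra k A}.

Arguments alg_const {k s}.

Definition alg_isomorphic (k : fieldType) (A B : pzAlgType k) : Prop :=
  exists f : {rmorphism A -> B},
    (forall c : k, f (alg_const c) = alg_const c) /\ bijective f.

Section RegularAlgebra.
Variable k : fieldType.

Lemma regular_scalar_central (c : k) (x : k^o) :
  (idfun c : k^o) * x = x * (idfun c : k^o).
Proof. exact: mulrC. Qed.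

HB.instance Definition _ := isPzAlgebra.Build k k^o regular_scalar_central.

End RegularAlgebra.

(** * Free algebras: the monoid algebra of the free monoid on [G] *)

Section FreeAlgebra.
Variables (k : fieldType) (G : choiceType).

Lemma malgC_central (c : k) (x : {malg k[{fmonom G}]}) :
  malgC c * x = x * malgC c.
Proof.
rewrite [x]monalgE mulr_suml mulr_sumr; apply: eq_bigr => m _.
have malgUU c1 c2 m1 m2 : (<< c1 *g m1 >> : {malg k[{fmonom G}]}) * << c2 *g m2 >>
    = << c1 * c2 *g mmul m1 m2 >> by exact: fgmulUU.
by rewrite !malgUU mulm1 mul1m mulrC.
Qed.

HB.instance Definition _ := isPzAlgebra.Build k (malg {fmonom G} k) malgC_central.

Definition free_gen (g : G) : {malg k[{fmonom G}]} := << fmu g >>.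

End FreeAlgebra.

(** * Quotient of an algebra by the two-sided ideal generated by a set *)

Section QuotientAlgebra.
Variables (k : fieldType) (A : pzAlgType k) (S : A -> Prop).

Inductive two_sided_ideal : A -> Prop :=
| ideal_gen x of S x : two_sided_ideal x
| ideal_0 : two_sided_ideal 0
| ideal_add x y of two_sided_ideal x & two_sided_ideal y :
    two_sided_ideal (x + y)
| ideal_mull a x of two_sided_ideal x : two_sided_ideal (a * x)
| ideal_mulr a x of two_sided_ideal x : two_sided_ideal (x * a).

Definition ideal_pred : {pred A} := fun x => `[< two_sided_ideal x >].

Lemma ideal_predP x : reflect (two_sided_ideal x) (x \in ideal_pred).
Proof. exact: asboolP. Qed.

Lemma ideal_pred_zmod_closed : zmod_closed ideal_pred.
Proof.
split=> [|x y /ideal_predP xI /ideal_predP yI]; apply/ideal_predP.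
  exact: ideal_0.
by apply: ideal_add => //; rewrite -mulN1r; apply: ideal_mull.
Qed.

HB.instance Definition _ :=
  GRing.isZmodClosed.Build A ideal_pred ideal_pred_zmod_closed.

Definition quot_alg : Type := Quotient.quot ideal_pred.

HB.instance Definition _ := GRing.Zmodule.on quot_alg.
HB.instance Definition _ := EqQuotient.on quot_alg.

Definition quot_pi (x : A) : quot_alg := \pi_quot_alg x.

Definition quot_one : quot_alg := quot_pi 1.
Definition quot_mul (x y : quot_alg) : quot_alg := quot_pi (repr x * repr y).

Lemma quot_piP x y : quot_pi x = quot_pi y <-> two_sided_ideal (x - y).
Proof.
split=> [/eqP|/ideal_predP xyI].
  by rewrite /quot_pi -Quotient.idealrBE => /ideal_predP.
by apply/eqP; rewrite /quot_pi -Quotient.idealrBE.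
Qed.

Lemma quot_reprK x : quot_pi (repr x) = x.
Proof. exact: reprK. Qed.

Lemma quot_reprP x : two_sided_ideal (repr (quot_pi x) - x).
Proof. by apply/quot_piP; rewrite quot_reprK. Qed.

Lemma quot_piD x y : quot_pi (x + y) = quot_pi x + quot_pi y.
Proof. by rewrite /quot_pi !piE. Qed.

Lemma quot_piM x y : quot_pi (x * y) = quot_mul (quot_pi x) (quot_pi y).
Proof.
apply/esym/quot_piP; set x' := repr _; set y' := repr _.
have ->: x' * y' - x * y = (x' - x) * y' + x * (y' - y).
  by rewrite mulrBl mulrBr addrA subrK.
by apply: ideal_add; [apply: ideal_mulr|apply: ideal_mull]; apply: quot_reprP.
Qed.

Lemma quot_ind (P : quot_alg -> Prop) :
  (forall x, P (quot_pi x)) -> forall x, P x.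
Proof. by move=> H x; rewrite -(quot_reprK x). Qed.

Lemma quot_mulA : associative quot_mul.
Proof.
elim/quot_ind=> x; elim/quot_ind=> y; elim/quot_ind=> z.
by rewrite -!quot_piM mulrA.
Qed.

Lemma quot_mul1r : left_id quot_one quot_mul.
Proof. by elim/quot_ind=> x; rewrite -quot_piM mul1r. Qed.

Lemma quot_mulr1 : right_id quot_one quot_mul.
Proof. by elim/quot_ind=> x; rewrite -quot_piM mulr1. Qed.

Lemma quot_mulDl : left_distributive quot_mul +%R.
Proof.
elim/quot_ind=> x; elim/quot_ind=> y; elim/quot_ind=> z.
by rewrite -quot_piD -!quot_piM -quot_piD mulrDl.
Qed.

Lemma quot_mulDr : right_distributive quot_mul +%R.
Proof.
elim/quot_ind=> x; elim/quot_ind=> y; elim/quot_ind=> z.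
by rewrite -quot_piD -!quot_piM -quot_piD mulrDr.
Qed.

HB.instance Definition _ := GRing.Zmodule_isPzRing.Build quot_alg
  quot_mulA quot_mul1r quot_mulr1 quot_mulDl quot_mulDr.

Definition quot_scalar (c : k) : quot_alg := quot_pi (alg_const c).

Lemma quot_scalar_zmod_morphism : zmod_morphism quot_scalar.
Proof.
move=> c d; apply: (canRL (addrK _)).
by rewrite /quot_scalar -quot_piD rmorphB subrK.
Qed.

Lemma quot_scalar_monoid_morphism : monoid_morphism quot_scalar.
Proof.
by split=> [|c d]; rewrite /quot_scalar ?rmorph1 // rmorphM quot_piM.
Qed.

HB.instance Definition _ :=
  GRing.isZmodMorphism.Build k quot_alg quot_scalar quot_scalar_zmod_morphism.
HB.instance Definition _ :=
  GRing.isMonoidMorphism.Build k quot_alg quot_scalar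
    quot_scalar_monoid_morphism.

Lemma quot_scalar_central (c : k) (x : quot_alg) :
  quot_scalar c * x = x * quot_scalar c.
Proof.
elim/quot_ind: x => x.
by rewrite /quot_scalar /GRing.mul /= -!quot_piM alg_const_central.
Qed.

HB.instance Definition _ :=
  isPzAlgebra.Build k quot_alg quot_scalar_central.

End QuotientAlgebra.

(** * Weights, roots and the Weyl group of a Cartan matrix *)

Section RootData.
Variables (I : finType) (a : I -> I -> int).

(* [d] consists of relatively prime positive integers with (d_i a_ij)
   symmetric *)
Definition symmetrizer (d : I -> nat) : Prop :=
  [/\ forall i, (0 < d i)%N,
      \big[gcdn/0%N]_i d i = 1%N &
      forall i j, (d i)%:Z * a i j = (d j)%:Z * a j i].

Definition root_form (d : I -> nat) (i j : I) : int := (d i)%:Z * a i j.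

(* A weight is recorded by its coordinates in the basis of fundamental
   weights: [lam i] is < h_i, lam >. *)
Definition weight := {ffun I -> int}.

Definition simple_root (j : I) : weight := [ffun i => a i j].

Definition fundamental_weight (i : I) : weight := [ffun j => (i == j)%:R].

(* An element of Q_+ is recorded by its coefficients on the simple roots. *)
Definition root_cone := {ffun I -> nat}.

Definition simple (i : I) : root_cone := [ffun j => (i == j : nat)].

Definition height (beta : root_cone) : nat := (\sum_i beta i)%N.

Definition root_weight (beta : root_cone) : weight :=
  \sum_i simple_root i *+ beta i.

Definition reflection (i : I) (lam : weight) : weight :=
  lam - simple_root i *~ lam i.

(* W is generated by the reflections, which are involutions, so its elements
   are the products of finite words in them. *)
Definition weyl_orbit (lam mu : weight) : Prop :=
  exists w : seq I, mu = foldr reflection lam w.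

(* For a minuscule dominant weight, the underlying set of the crystal B(lam)
   is the Weyl group orbit of lam, each element being its own weight. *)
Definition minuscule_crystal (lam : weight) := {mu : weight | weyl_orbit lam mu}.

Definition wt (lam : weight) (b : minuscule_crystal lam) : weight := sval b.

End RootData.

(** * Two-variable polynomials

    An element of k[u,v] is a [P : {poly {poly k}}], with [P`_p`_q] the
    coefficient of u^p v^q. *)

Section TwoVariables.
Variables (k : fieldType) (A : pzAlgType k).

(* P(u,v), for commuting u and v *)
Definition eval2 (P : {poly {poly k}}) (u v : A) : A :=
  \sum_(p < size P) \sum_(q < size P`_p) alg_const P`_p`_q * (u ^+ p * v ^+ q).

(* (P(u,v) - P(w,v)) / (u - w), for pairwise commuting u, v and w; see
   [divided_differenceP] *)
Definition divided_difference (P : {poly {poly k}}) (u v w : A) : A :=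
  \sum_(p < size P) \sum_(q < size P`_p)
    alg_const P`_p`_q * ((\sum_(r < p) u ^+ (p.-1 - r) * w ^+ r) * v ^+ q).

Lemma divided_differenceP P u v w : u * w = w * u ->
  (u - w) * divided_difference P u v w = eval2 P u v - eval2 P w v.
Proof.
move=> cuw; rewrite /divided_difference /eval2 mulr_sumr -sumrB.
apply: eq_bigr => p _; rewrite mulr_sumr -sumrB; apply: eq_bigr => q _.
transitivity (alg_const P`_p`_q * ((u ^+ p - w ^+ p) * v ^+ q)).
  by rewrite subrXX_comm // !mulrA alg_const_central.
by rewrite mulrBl mulrBr.
Qed.

End TwoVariables.

(** * Quiver Hecke algebras *)

Section QuiverHecke.
Variables (k : fieldType) (I : finType) (a : I -> I -> int) (d : I -> nat).
Variable Q : I -> I -> {poly {poly k}}.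

Definition quiver_hecke_polynomials : Prop :=
  [/\ forall i, Q i i = 0,
      forall i j p q, i != j -> (Q i j)`_p`_q != 0 ->
        root_form a d i i * p%:Z + root_form a d j j * q%:Z
          = - 2 * root_form a d i j,
      forall i j p q, (Q i j)`_p`_q = (Q j i)`_q`_p,
      forall i j, i != j -> (Q i j)`_`|a i j|`_0 != 0 &
      forall i j, root_form a d i j = 0 -> Q i j = 1].

Variable beta : root_cone I.
Local Notation N := (height beta).

(* I^beta *)
Definition words := {nu : {ffun 'I_N -> I} | \sum_j simple (nu j) == beta}.

Definition letter (nu : words) (j : 'I_N) : I := val nu j.

Lemma next_subproof (m : 'I_N.-1) : (m.+1 < N)%N.
Proof. by case: m => m /=; case: N. Qed.

(* The two strands crossed by tau_m. Places are numbered from 0. *)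
Definition left_pos (m : 'I_N.-1) : 'I_N := Ordinal (ltnW (next_subproof m)).
Definition right_pos (m : 'I_N.-1) : 'I_N := Ordinal (next_subproof m).

Definition transp (m : 'I_N.-1) : {perm 'I_N} :=
  tperm (left_pos m) (right_pos m).

Lemma swap_subproof (m : 'I_N.-1) (nu : words) :
  \sum_j simple ([ffun j => letter nu (transp m j)] j) == beta.
Proof.
apply/eqP; transitivity (\sum_j simple (letter nu j)); last exact/eqP/(valP nu).
rewrite [RHS](reindex_inj (@perm_inj _ (transp m))).
by apply: eq_bigr => j _; rewrite ffunE.
Qed.

Definition swap (m : 'I_N.-1) (nu : words) : words :=
  Sub [ffun j => letter nu (transp m j)] (swap_subproof m nu).

Definition qh_generator : Type := (words + 'I_N + 'I_N.-1)%type.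
HB.instance Definition _ := Finite.on qh_generator.

Local Notation F := {malg k[{fmonom qh_generator}]}.

Definition idem_gen (nu : words) : F := free_gen k (inl (inl nu) : qh_generator).
Definition x_gen (j : 'I_N) : F := free_gen k (inl (inr j) : qh_generator).
Definition tau_gen (m : 'I_N.-1) : F := free_gen k (inr m : qh_generator).

Local Notation e := idem_gen.
Local Notation x := x_gen.
Local Notation tau := tau_gen.

Inductive qh_relation : F -> F -> Prop :=
| rel_idem nu nu' :
    qh_relation (e nu * e nu') (if nu == nu' then e nu else 0)
| rel_sum_idem :
    qh_relation (\sum_nu e nu) 1
| rel_x_comm j l :
    qh_relation (x j * x l) (x l * x j)
| rel_x_idem j nu :
    qh_relation (x j * e nu) (e nu * x j)
| rel_tau_idem m nu :
    qh_relation (tau m * e nu) (e (swap m nu) * tau m)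
| rel_tau_comm (l m : 'I_N.-1) of (l.+1 < m)%N || (m.+1 < l)%N :
    qh_relation (tau l * tau m) (tau m * tau l)
| rel_tau_sqr m nu :
    qh_relation (tau m ^+ 2 * e nu)
      (eval2 (Q (letter nu (left_pos m)) (letter nu (right_pos m)))
             (x (left_pos m)) (x (right_pos m)) * e nu)
| rel_tau_x m j nu :
    qh_relation ((tau m * x j - x (transp m j) * tau m) * e nu)
      (if letter nu (left_pos m) == letter nu (right_pos m) then
         if j == left_pos m then - e nu
         else if j == right_pos m then e nu
         else 0
       else 0)
| rel_braid (m m' : 'I_N.-1) nu of m' = m.+1 :> nat :
    qh_relation ((tau m' * tau m * tau m' - tau m * tau m' * tau m) * e nu)
      (if letter nu (left_pos m) == letter nu (right_pos m') then
         divided_difference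
           (Q (letter nu (left_pos m)) (letter nu (right_pos m)))
           (x (left_pos m)) (x (right_pos m)) (x (right_pos m')) * e nu
       else 0).

(* R(beta) *)
Definition quiver_hecke : pzAlgType k :=
  quot_alg (fun r : F => exists y z, qh_relation y z /\ r = y - z).

Definition qh_e (nu : words) : quiver_hecke := quot_pi _ (e nu).
Definition qh_x (j : 'I_N) : quiver_hecke := quot_pi _ (x j).
Definition qh_tau (m : 'I_N.-1) : quiver_hecke := quot_pi _ (tau m).

(* The generators x_N^< h_{nu_N}, Lam > e(nu) of the cyclotomic ideal, for
   dominant [Lam]; there are none when N = 0. *)
Inductive cyclotomic_generator (Lam : weight I) : quiver_hecke -> Prop :=
| Cyclotomic_generator nu (last : 'I_N) of last.+1 = N :
    cyclotomic_generator Lam (qh_x last ^+ `|Lam (letter nu last)| * qh_e nu).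

(* R^Lam(Lam - beta) *)
Definition cyclotomic_quiver_hecke (Lam : weight I) : pzAlgType k :=
  quot_alg (cyclotomic_generator Lam).

End QuiverHecke.

(** * Type C_n

    The node i + 1 of the Dynkin diagram is [i : 'I_n]; the long simple root
    is the one at 0. *)

Definition cartanC (n : nat) (i j : 'I_n) : int :=
  if i == j then 2
  else if i.+1 == j then -1
  else if j.+1 == i then (if j == 0 :> nat then -2 else -1)
  else 0.

Definition symC (n : nat) (i : 'I_n) : nat := if i == 0 :> nat then 2 else 1.

Lemma symC_symmetrizer n : (2 <= n)%N -> symmetrizer (@cartanC n) (@symC n).
Proof.
move=> n2; split=> [i||i j].
- by rewrite /symC; case: ifP.
- by rewrite (bigD1 (Ordinal n2)) //= gcd1n.
rewrite /symC /cartanC [j == i]eq_sym.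
case: (i =P j) => [->//|_].
case: (i.+1 =P j) => [ij|_]; case: (j.+1 =P i) => [ji|_].
- by move: ij; rewrite -ji => /esym/eqP; rewrite -addn2 -[X in X == _]addn0 eqn_add2l.
- by rewrite -ij /=; case: (i == 0 :> nat).
- by rewrite -ji /=; case: (j == 0 :> nat).
by rewrite !mulr0.
Qed.

Lemma last_node_subproof n : (2 <= n)%N -> (n.-1 < n)%N.
Proof. by case: n. Qed.

Definition last_node (n : nat) (n_ge2 : (2 <= n)%N) : 'I_n :=
  Ordinal (last_node_subproof n_ge2).

(* Main.v *)
From HB Require Import structures.
Require Import Defs.
From mathcomp Require Import all_boot all_order perm all_algebra zify.
From mathcomp.multinomials Require Import monalg.

(* Read a word from its last letter. The arrows of B(Lambda_n) from the highest
   weight vertex spell the letters p_t = |n - 1 - t| (nodes numbered from 0), and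
   Lambda_n - beta is in the orbit exactly when beta = p_0 + ... + p_(t-1) for
   some t <= 2n - 1; moreover beta is then determined by its weight.

   Upper bound: by induction on t, [e(nu)] is zero unless the last t letters of
   nu are p_(t-1) ... p_0, and the last t variables [x] are zero. Let i be the
   next letter. If i is orthogonal to p_(t-1), then [e = tau ^ 2 e] factors
   through a word that is already known to vanish; if i = p_(t-1), the nilHecke
   relations give [e = 0]; if i = p_(t-2) is not p_t, both cubic terms of the
   braid relation vanish while the divided difference of Q is a nonzero scalar.
   If i = p_t, [tau ^ 2 e = 0] gives [c x e = 0], except at the double bond
   (p_t, p_(t-1)) = (1, 0), where the braid relation gives [c (x_t + x_(t-2)) e = 0].

   Lower bound: sending the path idempotent to 1 and all other generators to 0
   respects the relations, because neighbouring letters of the path are adjacent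
   nodes and its only factor i j i has a_ij = -2, so that the constant terms on
   the right-hand sides are zero. *)

Set Implicit Arguments.
Unset Strict Implicit.
Unset Printing Implicit Defensive.

Import GRing.Theory.
Local Open Scope ring_scope.

(** * Quotients, free algebras and two-variable polynomials *)

Section QuotientMorphisms.
Variables (k : fieldType) (A : pzAlgType k) (S : A -> Prop).

Lemma quot_pi_zmod_morphism : zmod_morphism (quot_pi S).
Proof. by move=> x y; apply: (canRL (addrK _)); rewrite -quot_piD subrK. Qed.

Lemma quot_pi_monoid_morphism : monoid_morphism (quot_pi S).
Proof. by split=> // x y; rewrite quot_piM. Qed.

HB.instance Definition _ :=
  GRing.isZmodMorphism.Build A (quot_alg S) (quot_pi S) quot_pi_zmod_morphism.
HB.instance Definition _ :=
  GRing.isMonoidMorphism.Build A (quot_alg S) (quot_pi S)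
    quot_pi_monoid_morphism.

Lemma quot_pi_eq0 x : S x -> quot_pi S x = 0.
Proof.
by move=> Sx; rewrite -(rmorph0 (quot_pi S)); apply/quot_piP; rewrite subr0;
  apply: ideal_gen.
Qed.

Variables (B : pzRingType) (g : {rmorphism A -> B}).
Hypothesis g_vanish : forall x, S x -> g x = 0.

Lemma ideal_vanish x : two_sided_ideal S x -> g x = 0.
Proof.
elim=> {x} [x /g_vanish//||x y _ gx _ gy|y x _ gx|y x _ gx].
- exact: rmorph0.
- by rewrite rmorphD gx gy addr0.
- by rewrite rmorphM gx mulr0.
- by rewrite rmorphM gx mul0r.
Qed.

Definition quot_lift (x : quot_alg S) : B := g (repr x).

Lemma quot_liftE x : quot_lift (quot_pi S x) = g x.
Proof.
by apply/eqP; rewrite -subr_eq0 -rmorphB; apply/eqP/ideal_vanish/quot_reprP.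
Qed.

Lemma quot_lift_zmod_morphism : zmod_morphism quot_lift.
Proof.
elim/quot_ind=> x; elim/quot_ind=> y.
by rewrite -(rmorphB (quot_pi S)) !quot_liftE rmorphB.
Qed.

Lemma quot_lift_monoid_morphism : monoid_morphism quot_lift.
Proof.
split=> [|]; first by rewrite -(rmorph1 (quot_pi S)) quot_liftE rmorph1.
elim/quot_ind=> x; elim/quot_ind=> y.
by rewrite -(rmorphM (quot_pi S)) !quot_liftE rmorphM.
Qed.

HB.instance Definition _ :=
  GRing.isZmodMorphism.Build (quot_alg S) B quot_lift quot_lift_zmod_morphism.
HB.instance Definition _ :=
  GRing.isMonoidMorphism.Build (quot_alg S) B quot_lift
    quot_lift_monoid_morphism.

(** Packaged as an existence statement, so that later arguments see only the value on classes and
    never a chosen representative. *)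
Lemma quot_lift_exists :
  exists f : {rmorphism quot_alg S -> B}, forall x, f (quot_pi S x) = g x.
Proof. by exists quot_lift => x; exact: quot_liftE. Qed.

End QuotientMorphisms.

Section FreeLift.
Variables (k : fieldType) (G : choiceType) (phi : G -> k).

Definition word_value (m : {fmonom G}) : k := \prod_(g <- (m : seq G)) phi g.

Lemma word_value_mmorphism : mmorphism word_value.
Proof.
split=> [m1 m2|]; rewrite /word_value; first by rewrite [mmul _ _]fmmulE big_cat.
by rewrite [mone]fmoneE big_nil.
Qed.

HB.instance Definition _ :=
  isMultiplicative.Build {fmonom G} k word_value word_value_mmorphism.

Lemma free_lift_exists :
  exists g : {rmorphism {malg k[{fmonom G}]} -> k^o},
    (forall c, g (alg_const c) = alg_const c) /\
    (forall x, g (free_gen k x) = phi x).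
Proof.
exists (mmap idfun word_value); split=> [c|x]; first exact: mmapC.
transitivity (idfun 1 * word_value (fmu x)); first exact: mmapU.
by rewrite /word_value fmuE big_seq1 mul1r.
Qed.

End FreeLift.

Section FreeInduction.
Variables (k : fieldType) (G : choiceType).
Local Notation F := {malg k[{fmonom G}]}.

Lemma free_ind (P : F -> Prop) :
    (forall c, P (alg_const c)) -> (forall g, P (free_gen k g)) ->
    (forall x y, P x -> P y -> P (x + y)) ->
    (forall x y, P x -> P y -> P (x * y)) ->
  forall x, P x.
Proof.
move=> Pc Pg PD PM x; rewrite [x]monalgE.
have UU c1 c2 (m1 m2 : {fmonom G}) : (<< c1 *g m1 >> : F) * << c2 *g m2 >>
    = << c1 * c2 *g mmul m1 m2 >> by exact: fgmulUU.
have P0 : P 0 by rewrite -(rmorph0 (@alg_const k F)).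
elim/big_ind: _ => // m _.
(* By additivity a single monomial remains; its word is peeled off one letter at a time, the
   coefficient staying on the tail. *)
case: m x => s x; move: (mcoeff _ _) => {x} c.
elim: s c => [|g s IHs] c.
  by have := Pc c; rewrite /alg_const /= /malgC /mone /= /fmone fmE.
have -> : << c *g FMonom (g :: s) >> = free_gen k g * << c *g FMonom s >>.
  by rewrite UU mul1r; congr (<< _ *g _ >>); rewrite fmuE [RHS]fmmulE.
exact: PM.
Qed.

End FreeInduction.

Section TwoVariableEvaluation.
Variable k : fieldType.
Implicit Types (A B : pzAlgType k) (P : {poly {poly k}}).

Lemma rmorph_eval2 A B (f : {rmorphism A -> B}) P u v :
  (forall c, f (alg_const c) = alg_const c) ->
  f (eval2 P u v) = eval2 P (f u) (f v).
Proof.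
move=> fc; rewrite /eval2 rmorph_sum; apply: eq_bigr => p _.
rewrite rmorph_sum; apply: eq_bigr => q _.
by rewrite !rmorphM !rmorphXn fc.
Qed.

Lemma rmorph_divided_difference A B (f : {rmorphism A -> B}) P u v w :
  (forall c, f (alg_const c) = alg_const c) ->
  f (divided_difference P u v w) = divided_difference P (f u) (f v) (f w).
Proof.
move=> fc; rewrite /divided_difference rmorph_sum; apply: eq_bigr => p _.
rewrite rmorph_sum; apply: eq_bigr => q _.
rewrite !rmorphM fc rmorphXn rmorph_sum; congr (_ * (_ * _)).
by apply: eq_bigr => r _; rewrite rmorphM !rmorphXn.
Qed.

(** The formula needs no bound on [(p0, q0)]: outside the ranges of summation the coefficient is
    zero by default. All evaluations below reduce to this one. *)
Lemma sum_single_monomial A P (F : nat -> nat -> A) p0 q0 :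
    (forall p q, (p, q) != (p0, q0) -> P`_p`_q != 0 -> F p q = 0) ->
  \sum_(p < size P) \sum_(q < size P`_p) alg_const P`_p`_q * F p q =
    alg_const P`_p0`_q0 * F p0 q0.
Proof.
move=> F0.
have z p q : (p, q) != (p0, q0) -> alg_const P`_p`_q * F p q = 0.
  move=> pq; have [->|nz] := eqVneq P`_p`_q 0; first by rewrite rmorph0 mul0r.
  by rewrite F0 ?mulr0.
have [lt_p|le_p] := ltnP p0 (size P); last first.
  rewrite (nth_default 0 le_p) coef0 rmorph0 mul0r big1 // => p _.
  rewrite big1 // => q _; apply: z; apply/eqP => -[pE _].
  by have := ltn_ord p; rewrite pE ltnNge le_p.
rewrite (bigD1 (Ordinal lt_p)) //= [X in _ + X]big1 ?addr0; last first.
  move=> p np; rewrite big1 // => q _; apply: z; apply/eqP => -[pE _].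
  by case/eqP: np; apply: val_inj.
have [lt_q|le_q] := ltnP q0 (size P`_p0); last first.
  rewrite (nth_default 0 le_q) rmorph0 mul0r big1 // => q _.
  apply: z; apply/eqP => -[qE].
  by have := ltn_ord q; rewrite qE ltnNge le_q.
rewrite (bigD1 (Ordinal lt_q)) //= [X in _ + X]big1 ?addr0 // => q nq.
by apply: z; apply/eqP => -[qE]; case/eqP: nq; apply: val_inj.
Qed.

Lemma eval2_1 A (u v : A) : eval2 1 u v = 1.
Proof.
rewrite /eval2 (sum_single_monomial (F := fun p q => u ^+ p * v ^+ q)
  (p0 := 0) (q0 := 0)).
  by rewrite coef1 eqxx coef1 eqxx rmorph1 !expr0 !mulr1.
by move=> [|p] [|q] // _; rewrite coef1 /= ?coef1 ?coef0 eqxx.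
Qed.

Lemma eval2_00 A P : eval2 P (0 : A) 0 = alg_const P`_0`_0.
Proof.
rewrite /eval2 (sum_single_monomial (F := fun p q => 0 ^+ p * 0 ^+ q)
  (p0 := 0) (q0 := 0)) ?expr0 ?mulr1 //.
by move=> [|p] [|q] pq _; rewrite ?eqxx // in pq *; rewrite expr0n ?mul0r // expr0n mulr0.
Qed.

(** The exponents of [u] and [w] in each term add up to [p - 1], so at zero only [p = 1], with
    [0 ^+ 0 = 1], survives. *)
Lemma divided_difference_000 A P :
  divided_difference P (0 : A) 0 0 = alg_const P`_1`_0.
Proof.
rewrite /divided_difference (sum_single_monomial
  (F := fun p q => (\sum_(r < p) 0 ^+ (p.-1 - r) * 0 ^+ r) * 0 ^+ q)
  (p0 := 1%N) (q0 := 0)) /= ?big_ord1 ?expr0 ?mulr1 //.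
move=> p [|q] pq _; last by rewrite exprS mul0r mulr0.
rewrite big1 ?mul0r // => r _.
case: p r pq => [[]//|[//|p]] r _ /=.
case: r => [[|r] hr] /=; last by rewrite [X in _ * X]exprS mul0r mulr0.
by rewrite subn0 exprS !mul0r.
Qed.

Lemma eval2_u0 A P (u : A) : P`_0`_0 = 0 ->
    (forall p q, P`_p.+1`_q != 0 -> p = 0 /\ q = 0) ->
  eval2 P u 0 = alg_const P`_1`_0 * u.
Proof.
move=> P00 P1; rewrite /eval2 (sum_single_monomial
  (F := fun p q => u ^+ p * 0 ^+ q) (p0 := 1%N) (q0 := 0)) ?expr1 ?mulr1 //.
move=> p [|q] pq nz; last by rewrite exprS mul0r mulr0.
by case: p pq nz => [|p]; rewrite ?P00 ?eqxx // => pq /P1[p0 _]; rewrite p0 in pq.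
Qed.

Lemma divided_difference_deg1 A P (u v w : A) :
    (forall p q, P`_p.+1`_q != 0 -> p = 0 /\ q = 0) ->
  divided_difference P u v w = alg_const P`_1`_0.
Proof.
move=> P1; rewrite /divided_difference (sum_single_monomial
  (F := fun p q => (\sum_(r < p) u ^+ (p.-1 - r) * w ^+ r) * v ^+ q)
  (p0 := 1%N) (q0 := 0)) /= ?big_ord1 ?expr0 ?mulr1 //.
move=> [|p] q pq nz; first by rewrite big_ord0 mul0r.
by case: (P1 _ _ nz) pq => -> ->.
Qed.

Lemma divided_difference_deg2 A P (u v w : A) :
    (forall p q, P`_p.+1`_q != 0 -> p = 1%N /\ q = 0) ->
  divided_difference P u v w = alg_const P`_2`_0 * (u + w).
Proof.
move=> P2; rewrite /divided_difference (sum_single_monomial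
  (F := fun p q => (\sum_(r < p) u ^+ (p.-1 - r) * w ^+ r) * v ^+ q)
  (p0 := 2%N) (q0 := 0)) /=.
  by rewrite big_ord_recl big_ord1 /= !expr0 !expr1 !mulr1 mul1r.
move=> [|p] q pq nz; first by rewrite big_ord0 mul0r.
by case: (P2 _ _ nz) pq => -> ->.
Qed.

End TwoVariableEvaluation.

(** * The weights of V(Lambda_n) *)

(** Nonsingularity of the Cartan matrix. Solving from the long end gives the constant value
    [2 * h 0] at every positive index, and the boundary value [h n = 0] then forces [h 0 = 0]. *)
Lemma cartanC_kernel0 (n : nat) (h : nat -> int) : (2 <= n)%N ->
    (forall i, (i < n)%N -> 2 * h i - h i.+1
       - (if i == 0%N then 0 else if i == 1%N then 2 else 1 : int) * h i.-1 = 0) ->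
  h n = 0 -> forall i, (i <= n)%N -> h i = 0.
Proof.
move=> n_ge2 hE hn.
have h2 i : (i < n)%N -> h i.+1 = 2 * h 0%N.
  elim/ltn_ind: i => -[|[|i]] IH lt_i.
  - by have := hE _ lt_i; rewrite /=; lia.
  - have h1 := IH 0%N isT (ltnW lt_i); have := hE _ lt_i; rewrite /=; lia.
  have hi1 := IH i.+1 (ltnSn _) (ltnW lt_i).
  have hi := IH i (ltnW (ltnSn _)) (ltnW (ltnW lt_i)).
  by have := hE _ lt_i; rewrite /=; lia.
have h0 : h 0%N = 0.
  have := h2 n.-1; rewrite prednK ?hn; lia.
by case=> // i /h2 ->; rewrite h0 mulr0.
Qed.

Section PathC.
Variables (n : nat) (n_ge2 : (2 <= n)%N).
Local Notation Lam := (fundamental_weight (last_node n_ge2)).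
Local Notation root_weight := (root_weight (@cartanC n)).

(* The label |n - 1 - t| of the arrow of B(Lambda_n) leaving the t-th vertex,
   counted from the highest weight; it is a node exactly when t <= 2n - 2. *)
Definition path_label (t : nat) : nat := ((n.-1 - t) + (t - n.-1))%N.

(** The labels descend to 0 at [r = n.-1] and then climb again; the entry -2 is met only on leaving
    the long root, from 0 to 1. *)
Lemma cartanC_path_label (i j : 'I_n) r :
    i = path_label r.+1 :> nat -> j = path_label r :> nat ->
  cartanC i j = if r == n.-1 then -2 else -1.
Proof.
rewrite /cartanC -val_eqE /path_label /= => -> ->.
by do !(case: eqP => //); lia.
Qed.

Definition path_node (t : nat) : 'I_n :=
  insubd (last_node n_ge2) (path_label t).

(** This is Lambda_(p_t) - Lambda_(p_(t-1)). The guard removes the second term at the highest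
    weight; at [t = n.*2.-1] the label is [n], which is no node, so the first term is zero. *)
Definition path_weight (t : nat) : weight 'I_n :=
  [ffun i : 'I_n => (val i == path_label t)%:R
     - ((0 < t)%N && (val i == path_label t.-1))%:R].

Definition path_root (t : nat) : root_cone 'I_n :=
  \sum_(s < t) simple (path_node s).

Lemma val_path_node t : (t < n.*2.-1)%N -> path_node t = path_label t :> nat.
Proof. by move=> ht; rewrite val_insubd /path_label ifT //; lia. Qed.

Lemma path_weight0 : path_weight 0 = Lam.
Proof.
apply/ffunP=> i; rewrite !ffunE subr0 /path_label -val_eqE /= eq_sym.
by congr (_ == _)%:R; lia.
Qed.

Lemma path_weightS t (i : 'I_n) : i = path_label t :> nat ->
  path_weight t.+1 = path_weight t - simple_root (@cartanC n) i.
Proof.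
move=> it; apply/ffunP=> j; rewrite !ffunE /cartanC -val_eqE /=.
have := ltn_ord j; move: it; rewrite /path_label.
move: (val i) (val j) => a b; rewrite !natz => it lt_b.
by case: t it => [|t] /= it; do !(case: eqP => ? /=); lia.
Qed.

(** The coordinate at [i] is 1 at p_t, -1 at p_(t-1) and 0 elsewhere, so the reflection moves one
    step down the string, one step up, or not at all. *)
Lemma reflection_path_weight t (i : 'I_n) : (t <= n.*2.-1)%N ->
  exists2 s, (s <= n.*2.-1)%N &
    reflection (@cartanC n) i (path_weight t) = path_weight s.
Proof.
move=> le_t; rewrite /reflection [path_weight t i]ffunE.
have lt_i := ltn_ord i.
have [it|nit] := eqVneq (val i) (path_label t).
  have -> : (0 < t)%N && (val i == path_label t.-1) = false.
    by move: it; rewrite /path_label /=; case: t {le_t} => //= t; lia.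
  exists t.+1; first by move: it; rewrite /path_label /=; lia.
  by rewrite subr0 mulr1z (path_weightS it).
case: t nit le_t => [|t] nit le_t /=; first by exists 0; rewrite ?subrr ?subr0.
have [it|nit'] := eqVneq (val i) (path_label t).
  exists t; first by lia.
  by rewrite sub0r mulrN1z opprK (path_weightS it) subrK.
by exists t.+1; rewrite ?subr0.
Qed.

Lemma weyl_orbit_path mu : weyl_orbit (@cartanC n) Lam mu ->
  exists2 t, (t <= n.*2.-1)%N & mu = path_weight t.
Proof.
case=> w ->; elim: w => [|i w [t le_t /= ->]] /=.
  by exists 0; rewrite ?path_weight0.
by have [s ? ->] := reflection_path_weight i le_t; exists s.
Qed.

Lemma root_weightD : {morph root_weight : b c / b + c}.
Proof.
move=> b c; rewrite /Defs.root_weight -big_split; apply: eq_bigr => i _ /=.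
by rewrite ffunE mulrnDr.
Qed.

Lemma root_weight_simple i : root_weight (simple i) = simple_root (@cartanC n) i.
Proof.
rewrite /Defs.root_weight (bigD1 i) //= big1 ?addr0 => [|j /negbTE ji].
  by rewrite ffunE eqxx mulr1n.
by rewrite ffunE eq_sym ji mulr0n.
Qed.

Lemma path_rootS t : path_root t.+1 = path_root t + simple (path_node t).
Proof. by rewrite /path_root big_ord_recr. Qed.

Lemma path_weightE t : (t <= n.*2.-1)%N ->
  path_weight t = Lam - root_weight (path_root t).
Proof.
elim: t => [|t IHt] le_t.
  rewrite path_weight0 /path_root big_ord0 /Defs.root_weight big1 ?subr0 //.
  by move=> i _; rewrite ffunE.
rewrite path_rootS root_weightD root_weight_simple opprD addrA -IHt; last by lia.
by apply: path_weightS; rewrite val_path_node.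
Qed.

Lemma height_path_root t : height (path_root t) = t.
Proof.
elim: t => [|t IHt].
  by rewrite /path_root big_ord0 /height big1 // => i _; rewrite ffunE.
rewrite path_rootS -[in RHS]IHt /height.
under eq_bigr do rewrite ffunE.
rewrite big_split /= [X in (_ + X)%N](bigD1 (path_node t)) //=.
rewrite [X in (_ + (_ + X))%N]big1 => [|j /negbTE ji].
  by rewrite ffunE eqxx addn0 addn1.
by rewrite ffunE eq_sym ji.
Qed.

(* The coefficients of [beta], extended by zero so that the equations at both
   ends of the Dynkin diagram keep the shape of the others. *)
Definition cone_coef (beta : root_cone 'I_n) (j : nat) : int :=
  if insub j is Some j' then (beta j')%:Z else 0.

(** Row [i] of the Cartan matrix has at most three nonzero entries. For [i = 0] the predecessor is
    again 0, whence the coefficient 0 there; the 2 in row 1 is the double bond. *)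
Lemma root_weightE (beta : root_cone 'I_n) (i : 'I_n) :
  root_weight beta i = 2 * cone_coef beta i - cone_coef beta i.+1
    - (if i == 0%N :> nat then 0 else if i == 1%N :> nat then 2 else 1 : int)
      * cone_coef beta i.-1.
Proof.
have sel m (c : int) : \sum_(j < n) (if j == m :> nat then c else 0) * (beta j)%:Z
    = c * cone_coef beta m.
  rewrite /cone_coef; case: insubP => [j _ jm|nm].
    rewrite (bigD1 j) //= jm eqxx big1 ?addr0 // => l nl.
    by rewrite -jm val_eqE (negbTE nl) mul0r.
  rewrite mulr0 big1 // => j _; case: eqP => [jm|]; last by rewrite mul0r.
  by rewrite -jm ltn_ord in nm.
rewrite /Defs.root_weight sum_ffunE.
set c := (if i == 0 :> nat then _ else _).
transitivity (\sum_(j < n) ((if j == i :> nat then 2 else 0) * (beta j)%:Z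
   - (if j == i.+1 :> nat then 1 else 0) * (beta j)%:Z
   - (if j == i.-1 :> nat then c else 0) * (beta j)%:Z)).
  apply: eq_bigr => j _; rewrite ffunMnE ffunE -[LHS]mulr_natr natz -!mulrBl.
  congr (_ * _); rewrite /cartanC /c -val_eqE /=.
  move: (nat_of_ord i) (nat_of_ord j) => a b.
  by case: a => [|[|a]] /=; do !(case: eqP => ? //=); lia.
by rewrite !sumrB !sel mul1r.
Qed.

(** The difference of two coefficient functions, extended by zero, satisfies the recurrence of
    [cartanC_kernel0] and vanishes at [n], which is not a node. *)
Lemma root_weight_inj : injective root_weight.
Proof.
move=> b c /ffunP bc.
have h0 : forall i, (i <= n)%N -> cone_coef b i - cone_coef c i = 0.
  apply: (cartanC_kernel0 n_ge2 (h := fun j => cone_coef b j - cone_coef c j)).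
    move=> i lt_i; have := bc (Ordinal lt_i); rewrite !root_weightE /=.
    by case: eqP => _; [|case: eqP => _]; lia.
  by rewrite /cone_coef insubF ?subrr // ltnn.
apply/ffunP=> i; have := h0 i (ltnW (ltn_ord i)).
by rewrite /cone_coef valK => /eqP; rewrite subr_eq0 => /eqP[].
Qed.

End PathC.

(** * Vanishing in the cyclotomic algebra *)

Section MorphismIdentities.
Variables (R S : pzRingType) (f : {rmorphism R -> S}).

(** These shapes are proved in abstract rings, so that the defining relations are transported by
    application instead of by rewriting in the concrete quotient. *)
Lemma rmorph_eqM a b r : f (a * b) = f r -> f a * f b = f r.
Proof. by rewrite rmorphM. Qed.

Lemma rmorph_eq_sqr a b r : f (a ^+ 2 * b) = f r -> f a * (f a * f b) = f r.
Proof. by rewrite rmorphM rmorphXn expr2 mulrA. Qed.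

Lemma rmorph_eq_commutator a b c d r :
  f ((a * b - c * a) * d) = f r -> (f a * f b - f c * f a) * f d = f r.
Proof. by rewrite rmorphM rmorphB !rmorphM. Qed.

Lemma rmorph_eq_braid a b c r :
  f ((a * b * a - b * a * b) * c) = f r ->
  (f a * f b * f a - f b * f a * f b) * f c = f r.
Proof. by rewrite rmorphM rmorphB !rmorphM. Qed.

End MorphismIdentities.

(* The relations used to bound [R^Lam] from above, isolated from the construction of
   the algebra so that computations take place in an abstract ring. *)
Record cyclotomic_relations (k : fieldType) (I : finType)
    (Q : I -> I -> {poly {poly k}}) (beta : root_cone I) (Lam : weight I)
    (A : pzAlgType k) (e : words beta -> A) (x : 'I_(height beta) -> A)
    (tau : 'I_(height beta).-1 -> A) : Prop := CyclotomicRelations {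
  crel_sum_e : \sum_nu e nu = 1;
  crel_x_e j nu : x j * e nu = e nu * x j;
  crel_tau_e m nu : tau m * e nu = e (swap m nu) * tau m;
  crel_tau_sqr m nu : tau m * (tau m * e nu) =
    eval2 (Q (letter nu (left_pos m)) (letter nu (right_pos m)))
          (x (left_pos m)) (x (right_pos m)) * e nu;
  crel_tau_x m j nu : letter nu (left_pos m) = letter nu (right_pos m) ->
    (tau m * x j - x (transp m j) * tau m) * e nu =
    if j == left_pos m then - e nu else if j == right_pos m then e nu else 0;
  crel_braid (m m' : 'I_(height beta).-1) nu : m' = m.+1 :> nat ->
    letter nu (left_pos m) = letter nu (right_pos m') ->
    (tau m' * tau m * tau m' - tau m * tau m' * tau m) * e nu =
    divided_difference (Q (letter nu (left_pos m)) (letter nu (right_pos m)))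
      (x (left_pos m)) (x (right_pos m)) (x (right_pos m')) * e nu;
  crel_last nu (j : 'I_(height beta)) : j.+1 = height beta ->
    x j ^+ `|Lam (letter nu j)| * e nu = 0
}.

Section CyclotomicRelations.
Variables (k : fieldType) (I : finType) (Q : I -> I -> {poly {poly k}}).
Variables (beta : root_cone I) (Lam : weight I).
Local Notation F := {malg k[{fmonom (qh_generator beta)}]}.
Local Notation A := (cyclotomic_quiver_hecke Q beta Lam).

Definition cyc_pi : F -> A := quot_pi _ \o quot_pi _.
HB.instance Definition _ := GRing.RMorphism.on cyc_pi.

Lemma cyc_pi_rel y z : qh_relation Q y z -> cyc_pi y = cyc_pi z.
Proof.
move=> yz; rewrite /cyc_pi /=; congr quot_pi; apply/quot_piP.
by apply: ideal_gen; exists y, z.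
Qed.

Lemma cyc_pi_relations : cyclotomic_relations Q Lam
  (fun nu => cyc_pi (idem_gen k nu)) (fun j => cyc_pi (x_gen k j))
  (fun m => cyc_pi (tau_gen k m)).
Proof.
have evalE P u v : cyc_pi (eval2 P u v) = eval2 P (cyc_pi u) (cyc_pi v).
  exact: rmorph_eval2.
have ddE P u v w : cyc_pi (divided_difference P u v w) =
    divided_difference P (cyc_pi u) (cyc_pi v) (cyc_pi w).
  exact: rmorph_divided_difference.
split=> [|j nu|m nu|m nu|m j nu lr|m m' nu mm' lr|nu j jN].
- transitivity (cyc_pi (\sum_nu idem_gen k nu)); first by rewrite rmorph_sum.
  by rewrite (cyc_pi_rel (rel_sum_idem Q beta)) rmorph1.
- exact: (etrans (rmorph_eqM (cyc_pi_rel (rel_x_idem Q j nu))) (rmorphM _ _ _)).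
- exact: (etrans (rmorph_eqM (cyc_pi_rel (rel_tau_idem Q m nu))) (rmorphM _ _ _)).
- apply: etrans (rmorph_eq_sqr (cyc_pi_rel (rel_tau_sqr Q m nu))) _.
  exact: etrans (rmorphM _ _ _) (congr1 (fun z => z * _) (evalE _ _ _)).
- apply: etrans (rmorph_eq_commutator (cyc_pi_rel (rel_tau_x Q m j nu))) _.
  rewrite lr eqxx; case: ifP => _; first exact: rmorphN.
  by case: ifP => _; [reflexivity | exact: rmorph0].
- apply: etrans (rmorph_eq_braid (cyc_pi_rel (rel_braid Q nu mm'))) _.
  rewrite lr eqxx.
  exact: etrans (rmorphM _ _ _) (congr1 (fun z => z * _) (ddE _ _ _ _)).
have := quot_pi_eq0 (Cyclotomic_generator Q Lam nu jN).
by rewrite rmorphM rmorphXn.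
Qed.

End CyclotomicRelations.

Lemma alg_const_cancel (k : fieldType) (A : pzAlgType k) (c : k) (y : A) :
  c != 0 -> alg_const c * y = 0 -> y = 0.
Proof.
move=> c0 cy; rewrite -[y]mul1r -(rmorph1 (@alg_const k A)) -(mulVf c0) rmorphM.
by rewrite -mulrA cy mulr0.
Qed.

(** * Monomials of the polynomials Q_ij in type C_n *)

Section HeckePolynomialsC.
Variables (k : fieldType) (n : nat) (Q : 'I_n -> 'I_n -> {poly {poly k}}).
Hypothesis hQ : quiver_hecke_polynomials (@cartanC n) (@symC n) Q.
Implicit Types i j : 'I_n.

Lemma cartanC_neq i j : cartanC i j != 2 -> i != j.
Proof. by apply: contraNneq => ->; rewrite /cartanC eqxx. Qed.

Lemma Qpoly_orth i j : cartanC i j = 0 -> Q i j = 1.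
Proof. by case: hQ => _ _ _ _ H aij; apply: H; rewrite /root_form aij mulr0. Qed.

(** By homogeneity: the constant monomial has degree 0, while the prescribed degree -2(alpha_i,
    alpha_j) is nonzero. *)
Lemma Qpoly_coef00 i j : i != j -> cartanC i j != 0 -> (Q i j)`_0`_0 = 0.
Proof.
case: hQ => _ H _ _ _ ij aij; apply/eqP; apply: contraT => /(H _ _ _ _ ij).
rewrite !mulr0 addr0 /root_form => /esym/eqP.
by rewrite !mulf_eq0 (negbTE aij) /symC; case: ifP.
Qed.

(** The prescribed degree equals (alpha_i, alpha_i), so a single factor u already exhausts it. *)
Lemma Qpoly_supp1 i j p q :
  cartanC i j = -1 -> (Q i j)`_p.+1`_q != 0 -> p = 0%N /\ q = 0%N.
Proof.
case: hQ => _ H _ _ _ aij; have ij : i != j by apply: cartanC_neq; rewrite aij.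
move/(H _ _ _ _ ij); rewrite /root_form aij /cartanC !eqxx /symC.
by do 2![case: ifP => _]; lia.
Qed.

(** Here [j] is the long root and [i] is short, so the degree condition reads 2(p + 1) + 4q = 4,
    which leaves only u^2. *)
Lemma Qpoly_supp2 i j p q :
  cartanC i j = -2 -> (Q i j)`_p.+1`_q != 0 -> p = 1%N /\ q = 0%N.
Proof.
case: hQ => _ H _ _ _ aij; have ij : i != j by apply: cartanC_neq; rewrite aij.
move/(H _ _ _ _ ij); rewrite /root_form aij; move: aij.
rewrite /cartanC !eqxx /symC (negbTE ij).
by case: eqP => // ?; case: eqP => // ji; case: eqP => // j0; case: eqP; lia.
Qed.

Lemma Qpoly_lead i j : i != j -> (Q i j)`_`|cartanC i j|`_0 != 0.
Proof. by case: hQ => _ _ _ H _; apply: H. Qed.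

End HeckePolynomialsC.

(* Positions are counted from the right, since the cyclotomic relation bears
   on the last letter. *)
Definition depth (N : nat) (j : 'I_N) : nat := N.-1 - j.

Lemma depth_left_pos (I : finType) (beta : root_cone I) (m : 'I_(height beta).-1) :
  depth (left_pos m) = (depth (right_pos m)).+1.
Proof. by rewrite /depth /=; have := ltn_ord m; lia. Qed.

Lemma exists_left_pos (N : nat) (j : 'I_N) : (0 < N.-1 - j)%N ->
  exists m : 'I_N.-1, m = j :> nat.
Proof. by rewrite subn_gt0 => lt_j; exists (Ordinal lt_j). Qed.

Section Vanishing.
Variables (k : fieldType) (n : nat) (n_ge2 : (2 <= n)%N).
Variable Q : 'I_n -> 'I_n -> {poly {poly k}}.
Hypothesis hQ : quiver_hecke_polynomials (@cartanC n) (@symC n) Q.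
Variable beta : root_cone 'I_n.
Local Notation N := (height beta).
Local Notation Lam := (fundamental_weight (last_node n_ge2)).
Variables (A : pzAlgType k) (e : words beta -> A) (x : 'I_N -> A).
Variable tau : 'I_N.-1 -> A.
Hypothesis rels : cyclotomic_relations Q Lam e x tau.
Implicit Types (nu : words beta) (j : 'I_N) (m : 'I_N.-1) (t : nat).
Local Notation path_label := (path_label n).

Definition path_suffix t nu : bool :=
  [forall j, (depth j < t)%N ==> (letter nu j == path_label (depth j) :> nat)].

Definition vanishing_below t : Prop :=
  (forall nu, ~~ path_suffix t nu -> e nu = 0) /\
  (forall j, (depth j < t)%N -> x j = 0).

Lemma path_suffixP t nu j : path_suffix t nu -> (depth j < t)%N ->
  letter nu j = path_label (depth j) :> nat.
Proof. by move=> /forallP/(_ j)/implyP H /H/eqP. Qed.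

Lemma tau_e_vanish t m nu : vanishing_below t -> (depth (right_pos m) < t)%N ->
  letter nu (left_pos m) <> path_label (depth (right_pos m)) :> nat ->
  tau m * e nu = 0.
Proof.
case=> e0 _ lt_t neq; rewrite (crel_tau_e rels) e0 ?mul0r //.
apply: contra_notN neq => /path_suffixP/(_ lt_t) <-.
by rewrite /letter /= ffunE tpermR.
Qed.

(** The two cubic terms end in [tau m' * e nu] and [tau m * e nu], and each of these crossings leads
    to a vanishing word. *)
Lemma braid_vanish t m m' nu : vanishing_below t -> m' = m.+1 :> nat ->
    (depth (right_pos m) < t)%N ->
    letter nu (left_pos m) = letter nu (right_pos m') ->
    letter nu (left_pos m) <> path_label (depth (right_pos m)) :> nat ->
    letter nu (right_pos m) <> path_label (depth (right_pos m')) :> nat ->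
  divided_difference (Q (letter nu (left_pos m)) (letter nu (right_pos m)))
    (x (left_pos m)) (x (right_pos m)) (x (right_pos m')) * e nu = 0.
Proof.
move=> vt mm' lt_t lr nl nr; rewrite -(crel_braid rels mm' lr).
have t1 : tau m * e nu = 0 by apply: tau_e_vanish vt lt_t nl.
have lm' : left_pos m' = right_pos m by apply: val_inj.
have t2 : tau m' * e nu = 0.
  apply: (tau_e_vanish vt); rewrite ?lm' //.
  by apply: leq_trans lt_t; rewrite -lm' depth_left_pos.
by rewrite mulrBl -!mulrA t1 t2 !mulr0 subr0.
Qed.

(* With [x (right_pos m) = 0] the two relations exchanging [x] and [tau] read
   [tau x e = - e] and [x tau e = - e]; so [tau e = - tau ^ 2 x e = 0]. *)
Lemma equal_letters_vanish m nu :
  letter nu (left_pos m) = letter nu (right_pos m) -> x (right_pos m) = 0 ->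
  e nu = 0.
Proof.
move=> lr xr0.
have rl : (right_pos m == left_pos m) = false.
  by apply/eqP => /(congr1 val) /=; lia.
have := crel_tau_x rels (right_pos m) lr; rewrite rl eqxx /transp tpermR xr0.
rewrite mulr0 sub0r mulNr -mulrA => xt.
have := crel_tau_x rels (left_pos m) lr; rewrite eqxx /transp tpermL xr0.
rewrite mul0r subr0 -mulrA => tx.
have te0 : tau m * e nu = 0.
  apply: oppr_inj; rewrite oppr0 -mulrN -tx (crel_x_e rels).
  rewrite [tau m * (e nu * _)]mulrA [LHS]mulrA (crel_tau_sqr rels) lr.
  by case: hQ => -> _ _ _ _; rewrite /eval2 size_poly0 big_ord0 !mul0r.
by rewrite -xt te0 mulr0 oppr0.
Qed.

Lemma e_vanish t j nu : vanishing_below t -> (t < n.*2)%N -> depth j = t ->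
  letter nu j <> path_label t :> nat -> e nu = 0.
Proof.
move=> vt lt_t jt neq.
have [good|/(proj1 vt)//] := boolP (path_suffix t nu).
have lt_j := ltn_ord j; have lt_l := ltn_ord (letter nu j).
(* At the last letter the cyclotomic exponent is 0 unless the letter is p_0, and with exponent 0 the
   relation itself says [e nu = 0]. *)
have [t0|t_gt0] := posnP t.
  have jN : j.+1 = N by rewrite /depth in jt; lia.
  rewrite -(crel_last rels nu jN) ffunE -val_eqE /=.
  case: eqP => [lj|]; last by rewrite expr0 mul1r.
  by case: neq; rewrite -lj t0 /path_label; lia.
have [m mj] := exists_left_pos (etrans (congr1 _ jt) t_gt0).
have {mj} jE : j = left_pos m by apply: val_inj; rewrite /= mj.
move: jt neq lt_l; rewrite jE depth_left_pos => {jE lt_j j}.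
set r := depth _ => rt neq lt_l; have lt_rt : (r < t)%N by rewrite -rt.
have lr := path_suffixP good lt_rt.
have xr0 : x (right_pos m) = 0 by apply: (proj2 vt).
have [eq_lr|neq_lr] := eqVneq (letter nu (left_pos m)) (letter nu (right_pos m)).
  exact: equal_letters_vanish eq_lr xr0.
have neq_l : letter nu (left_pos m) <> path_label r :> nat.
  by rewrite -lr => /val_inj rl; rewrite rl eqxx in neq_lr.
have te0 := tau_e_vanish vt lt_rt neq_l.
have [orth|adj] := eqVneq (cartanC (letter nu (left_pos m)) (letter nu (right_pos m))) 0.
  have := crel_tau_sqr rels m nu.
  by rewrite te0 mulr0 (Qpoly_orth hQ orth) eval2_1 mul1r.
(* The neighbours of p_r are among p_(r-1) and p_(r+1), and the latter is excluded. For [r = 0] only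
   p_1 would remain. The entry -2 would require p_r = 0 and left letter 1, which is p_(r+1). *)
have [r_gt0 ll a1] : [/\ (0 < r)%N,
    letter nu (left_pos m) = path_label r.-1 :> nat &
    cartanC (letter nu (left_pos m)) (letter nu (right_pos m)) = -1].
  move: neq_lr adj neq neq_l lr lt_l lt_t; rewrite /cartanC -val_eqE /= -rt.
  move: (nat_of_ord (letter nu (left_pos m))) (nat_of_ord (letter nu (right_pos m))).
  move=> a b /negbTE ->; rewrite /path_label.
  case: (a.+1 =P b) => ?; last case: (b.+1 =P a) => ? //.
    by move=> _ *; split; lia.
  by case: (b =P 0) => ? _ *; split; lia.
(* The crossing [m'] is the next one to the right; the three letters involved form a pattern i j
   i. *)
have [m' mm'] := exists_left_pos r_gt0; rewrite /= in mm'.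
have r'E : depth (right_pos m') = r.-1.
  have -> : r = depth (left_pos m').
    by congr depth; apply: val_inj; rewrite /= mm'.
  by rewrite depth_left_pos.
have lr' := path_suffixP (j := right_pos m') good.
rewrite r'E in lr'.
have lt_r't : (r.-1 < t)%N by lia.
have lrE : letter nu (left_pos m) = letter nu (right_pos m').
  by apply: val_inj; rewrite /= ll lr'.
have nr : letter nu (right_pos m) <> path_label (depth (right_pos m')) :> nat.
  by rewrite r'E -ll => /val_inj rl; rewrite rl eqxx in neq_lr.
have := braid_vanish vt mm' lt_rt lrE neq_l nr.
rewrite (divided_difference_deg1 _ _ _ (fun p q => Qpoly_supp1 hQ a1)).
apply: alg_const_cancel; have := Qpoly_lead hQ neq_lr; rewrite a1.
exact.
Qed.

Lemma x_vanish t j nu : vanishing_below t -> (t.+1 < n.*2)%N -> depth j = t ->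
  path_suffix t.+1 nu -> x j * e nu = 0.
Proof.
move=> vt lt_t jt good.
have lj : letter nu j = path_label t :> nat.
  by rewrite -jt; apply: path_suffixP good _; rewrite jt.
have lt_j := ltn_ord j.
have [t0|t_gt0] := posnP t.
  have jN : j.+1 = N by rewrite /depth in jt; lia.
  have := crel_last rels nu jN; rewrite ffunE -val_eqE /= lj t0.
  by rewrite /path_label sub0n subn0 addn0 eqxx expr1.
have [m mj] := exists_left_pos (etrans (congr1 _ jt) t_gt0).
have {mj} jE : j = left_pos m by apply: val_inj; rewrite /= mj.
move: jt lj; rewrite jE depth_left_pos => {jE lt_j j}.
set r := depth _ => rt ll; have lt_rt : (r < t)%N by rewrite -rt.
have lr := path_suffixP good (leqW lt_rt).
have xr0 : x (right_pos m) = 0 by apply: (proj2 vt).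
have neq_l : letter nu (left_pos m) <> path_label r :> nat.
  by rewrite ll -rt /path_label; lia.
have neq_lr : letter nu (left_pos m) != letter nu (right_pos m).
  by apply/eqP => /(congr1 val); rewrite /= lr.
have te0 := tau_e_vanish vt lt_rt neq_l.
(* Away from the turn, [tau m] squared acts on [e nu] as a nonzero multiple of x. At the turn it
   would only give x^2, so the braid relation is used there. *)
have [rn|rn] := eqVneq r n.-1; last first.
  have a1 : cartanC (letter nu (left_pos m)) (letter nu (right_pos m)) = -1.
    by rewrite (cartanC_path_label n_ge2 (r := r)) ?rt // (negbTE rn).
  have := crel_tau_sqr rels m nu; rewrite te0 mulr0 xr0 eval2_u0.
  - move=> /esym; rewrite -mulrA; apply: alg_const_cancel.
    by have := Qpoly_lead hQ neq_lr; rewrite a1.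
  - by rewrite (Qpoly_coef00 hQ neq_lr) ?a1.
  by move=> p q; apply: Qpoly_supp1.
have a2 : cartanC (letter nu (left_pos m)) (letter nu (right_pos m)) = -2.
  by rewrite (cartanC_path_label n_ge2 (r := r)) ?rt // rn eqxx.
have r_gt0 : (0 < r)%N by lia.
have [m' mm'] := exists_left_pos r_gt0; rewrite /= in mm'.
have r'E : depth (right_pos m') = r.-1.
  have -> : r = depth (left_pos m').
    by congr depth; apply: val_inj; rewrite /= mm'.
  by rewrite depth_left_pos.
have lt_r't : (r.-1 < t)%N by lia.
have lr' : letter nu (right_pos m') = path_label r.-1 :> nat.
  by rewrite -r'E; apply: path_suffixP good _; rewrite r'E; lia.
have lrE : letter nu (left_pos m) = letter nu (right_pos m').
  by apply: val_inj; rewrite /= ll lr' -rt /path_label; lia.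
have nr : letter nu (right_pos m) <> path_label (depth (right_pos m')) :> nat.
  by rewrite r'E lr /path_label; lia.
have xr'0 : x (right_pos m') = 0 by apply: (proj2 vt); rewrite r'E.
have := braid_vanish vt mm' lt_rt lrE neq_l nr.
rewrite (divided_difference_deg2 _ _ _ (fun p q => Qpoly_supp2 hQ a2)) xr'0 addr0.
rewrite -mulrA; apply: alg_const_cancel.
by have := Qpoly_lead hQ neq_lr; rewrite a2.
Qed.

Lemma vanishing_step t : (t.+1 < n.*2)%N -> vanishing_below t ->
  vanishing_below t.+1.
Proof.
move=> lt_t vt; have e0 nu : ~~ path_suffix t.+1 nu -> e nu = 0.
  rewrite negb_forall => /existsP[j]; rewrite negb_imply ltnS => /andP[le_j /eqP].
  move: le_j; rewrite leq_eqVlt => /predU1P[jt|lt_j] neq.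
    by apply: (e_vanish vt _ jt); [apply: ltnW | rewrite -jt].
  by apply: (proj1 vt); apply: contra_notN neq => /path_suffixP; apply.
split=> // j; rewrite ltnS leq_eqVlt => /predU1P[jt|/(proj2 vt)//].
(* Decomposing 1 into the idempotents turns the vanishing of each [x j * e nu] into that of
   [x j]. *)
rewrite -[x j]mulr1 -(crel_sum_e rels) mulr_sumr big1 // => nu _.
have [good|/e0->] := boolP (path_suffix t.+1 nu); last by rewrite mulr0.
exact: x_vanish vt lt_t jt good.
Qed.

Lemma vanishing t : (t < n.*2)%N -> vanishing_below t.
Proof.
elim: t => [|t IHt] lt_t; last by apply: vanishing_step => //; apply/IHt/ltnW.
by split=> // nu /negP[]; rewrite /path_suffix; apply/forallP => j.
Qed.

Lemma x_eq0 j : (N < n.*2)%N -> x j = 0.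
Proof.
move=> /vanishing[_ x0]; apply: x0; rewrite /depth.
by have := ltn_ord j; lia.
Qed.

(** Only the path word has a possibly nonzero idempotent, and its consecutive letters differ, so
    every crossing leaves it. *)
Lemma tau_eq0 m : (N < n.*2)%N -> tau m = 0.
Proof.
move=> /vanishing vN; have lt_r : (depth (right_pos m) < N)%N.
  by rewrite /depth; have := ltn_ord (right_pos m); lia.
have lt_l : (depth (left_pos m) < N)%N.
  by rewrite /depth; have := ltn_ord (left_pos m); lia.
rewrite -[tau m]mulr1 -(crel_sum_e rels) mulr_sumr big1 // => nu _.
have [good|/(proj1 vN)->] := boolP (path_suffix N nu); last by rewrite mulr0.
apply: (tau_e_vanish vN lt_r); rewrite (path_suffixP good lt_l) depth_left_pos.
by rewrite /path_label; lia.
Qed.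

End Vanishing.

(** * The one-dimensional module *)

Section PathModule.
Variables (k : fieldType) (n : nat) (n_ge2 : (2 <= n)%N).
Variable Q : 'I_n -> 'I_n -> {poly {poly k}}.
Hypothesis hQ : quiver_hecke_polynomials (@cartanC n) (@symC n) Q.
Variable beta : root_cone 'I_n.
Local Notation N := (height beta).
Local Notation Lam := (fundamental_weight (last_node n_ge2)).
Local Notation F := {malg k[{fmonom (qh_generator beta)}]}.
Local Notation A := (cyclotomic_quiver_hecke Q beta Lam).
Variable nu0 : words beta.
Hypothesis nu0E : forall j, letter nu0 j = path_label n (depth j) :> nat.

Lemma letter_neq m : letter nu0 (left_pos m) != letter nu0 (right_pos m).
Proof.
apply/eqP => /(congr1 val) /=; rewrite !nu0E depth_left_pos /path_label; lia.
Qed.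

Lemma cartanC_letter m :
  cartanC (letter nu0 (left_pos m)) (letter nu0 (right_pos m)) != 0.
Proof.
rewrite (cartanC_path_label n_ge2 (r := depth (right_pos m))) ?nu0E ?depth_left_pos //.
by case: ifP.
Qed.

(** Two labels at distance two along the path agree only around the turn, where the pattern is 1 0
    1. *)
Lemma cartanC_turn (m m' : 'I_N.-1) : m' = m.+1 :> nat ->
    letter nu0 (left_pos m) = letter nu0 (right_pos m') ->
  cartanC (letter nu0 (left_pos m)) (letter nu0 (right_pos m)) = -2.
Proof.
move=> mm' /(congr1 val) /=; rewrite !nu0E depth_left_pos => eq_r.
rewrite (cartanC_path_label n_ge2 (r := depth (right_pos m))) ?nu0E ?depth_left_pos //.
have rm : right_pos m = left_pos m' by apply: val_inj.
by move: eq_r; rewrite rm depth_left_pos /path_label; case: eqP => //; lia.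
Qed.

Definition path_value (g : qh_generator beta) : k :=
  if g is inl (inl nu) then (nu == nu0)%:R else 0.

Variable g : {rmorphism F -> k^o}.
Hypothesis gC : forall c, g (alg_const c) = alg_const c.
Hypothesis gE : forall y, g (free_gen k y) = path_value y.

Lemma rmorph_mul0l (y z : F) : g y = 0 -> g (y * z) = 0.
Proof. by move=> y0; rewrite rmorphM y0 mul0r. Qed.

Lemma rmorph_mul0r (y z : F) : g z = 0 -> g (y * z) = 0.
Proof. by move=> z0; rewrite rmorphM z0 mulr0. Qed.

Lemma rmorph_sub0 (y z : F) : g y = 0 -> g z = 0 -> g (y - z) = 0.
Proof. by move=> y0 z0; rewrite rmorphB y0 z0 subr0. Qed.

Lemma g_e nu : g (idem_gen k nu) = (nu == nu0)%:R.
Proof. exact: gE. Qed.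

Lemma g_e0 nu : nu != nu0 -> g (idem_gen k nu) = 0.
Proof. by move=> /negbTE ne; rewrite g_e ne. Qed.

Lemma g_x j : g (x_gen k j) = 0.
Proof. exact: gE. Qed.

Lemma g_tau m : g (tau_gen k m) = 0.
Proof. exact: gE. Qed.

Lemma g_rel y z : qh_relation Q y z -> g y = g z.
Proof.
case=> {y z} [nu nu'||j l|j nu|m nu|l m _|m nu|m j nu|m m' nu mm'].
- apply: etrans (rmorphM _ _ _) _; apply: etrans (congr2 _ (g_e _) (g_e _)) _.
  have [<-|ne] := eqVneq nu nu'.
    by apply: etrans _ (esym (g_e _)); case: eqVneq => _; rewrite ?mulr1 ?mulr0.
  apply: etrans _ (esym (rmorph0 _)).
  have [nuE|_] := eqVneq nu nu0; last by rewrite mul0r.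
  by rewrite -nuE eq_sym (negbTE ne) mulr0.
- apply: etrans (rmorph_sum _ _ _ _) _; apply: etrans _ (esym (rmorph1 _)).
  rewrite (eq_bigr _ (fun nu _ => g_e nu)) (bigD1 nu0) //= eqxx big1 ?addr0 //.
  by move=> nu /negbTE->.
- exact: etrans (rmorph_mul0l _ (g_x _)) (esym (rmorph_mul0l _ (g_x _))).
- exact: etrans (rmorph_mul0l _ (g_x _)) (esym (rmorph_mul0r _ (g_x _))).
- exact: etrans (rmorph_mul0l _ (g_tau _)) (esym (rmorph_mul0r _ (g_tau _))).
- exact: etrans (rmorph_mul0l _ (g_tau _)) (esym (rmorph_mul0l _ (g_tau _))).
- apply: etrans (rmorph_mul0l _ (rmorph_mul0l _ (g_tau _))) (esym _).
  have [->|ne] := eqVneq nu nu0; last exact: rmorph_mul0r (g_e0 ne).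
  apply: rmorph_mul0l; apply: etrans (rmorph_eval2 _ _ _ gC) _.
  rewrite !g_x eval2_00 (Qpoly_coef00 hQ (letter_neq m) (cartanC_letter m)).
  exact: rmorph0.
- have z0 : g (tau_gen k m * x_gen k j - x_gen k (transp m j) * tau_gen k m) = 0.
    exact: rmorph_sub0 (rmorph_mul0l _ (g_tau _)) (rmorph_mul0r _ (g_tau _)).
  apply: etrans (rmorph_mul0l _ z0) (esym _).
  case: eqP => [lr|_]; last exact: rmorph0.
  (* A nonzero right-hand side needs equal neighbouring letters, which the path word does not
     have. *)
  have ne : nu != nu0.
    by apply/eqP => nuE; have := letter_neq m; rewrite -nuE lr eqxx.
  case: ifP => _; first by apply: etrans (rmorphN _ _) _; rewrite (g_e0 ne) oppr0.
  by case: ifP => _; [exact: g_e0 | exact: rmorph0].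
have z0 : g (tau_gen k m' * tau_gen k m * tau_gen k m' -
             tau_gen k m * tau_gen k m' * tau_gen k m) = 0.
  exact: rmorph_sub0 (rmorph_mul0r _ (g_tau _)) (rmorph_mul0r _ (g_tau _)).
apply: etrans (rmorph_mul0l _ z0) (esym _).
case: eqP => [lr|_]; last exact: rmorph0.
have [nuE|ne] := eqVneq nu nu0; last exact: rmorph_mul0r (g_e0 ne).
apply: rmorph_mul0l; apply: etrans (rmorph_divided_difference _ _ _ _ gC) _.
rewrite !g_x divided_difference_000 nuE; rewrite nuE in lr.
(* In the factor i j i of the path the only monomial of Q involving u is u^2, so the linear
   coefficient is zero. *)
set P := Q _ _; have -> : P`_1`_0 = 0; last exact: rmorph0.
by apply/eqP; apply: contraT => /(Qpoly_supp2 hQ (cartanC_turn mm' lr))[].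
Qed.

Lemma path_character_exists :
  exists f : {rmorphism A -> k^o}, forall c, f (alg_const c) = alg_const c.
Proof.
have g_vanish y : (exists y1 z1, qh_relation Q y1 z1 /\ y = y1 - z1) -> g y = 0.
  case=> y1 [z1 [/g_rel y1z1 ->]]; apply: etrans (rmorphB _ _ _) _.
  by rewrite y1z1 subrr.
have [h hE] := quot_lift_exists g_vanish.
have h_vanish y : @cyclotomic_generator _ _ Q beta Lam y -> h y = 0.
  case=> nu last lastN; apply: etrans (rmorphM _ _ _) _.
  have [nuE|ne] := eqVneq nu nu0; last first.
    by rewrite /qh_e hE (g_e0 ne) mulr0.
  apply: etrans (congr2 _ (rmorphXn _ _ _) (erefl _)) _.
  (* The last letter of the path word is p_0, so the cyclotomic exponent is 1 and the generator
     contains the factor x, sent to 0. *)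
  have last0 : depth last = 0%N by rewrite /depth; lia.
  rewrite /qh_x hE g_x ffunE -val_eqE /= nuE nu0E last0.
  by rewrite /path_label sub0n subn0 addn0 eqxx expr1 mul0r.
have [f fE] := quot_lift_exists h_vanish.
exists f => c; exact: etrans (fE _) (etrans (hE _) (gC c)).
Qed.

End PathModule.

(** * The isomorphism with k *)

Section PathAlgebra.
Variables (k : fieldType) (n : nat) (n_ge2 : (2 <= n)%N).
Variable Q : 'I_n -> 'I_n -> {poly {poly k}}.
Hypothesis hQ : quiver_hecke_polynomials (@cartanC n) (@symC n) Q.
Variable beta : root_cone 'I_n.
Local Notation N := (height beta).
Local Notation Lam := (fundamental_weight (last_node n_ge2)).
Local Notation A := (cyclotomic_quiver_hecke Q beta Lam).
Hypothesis lt_N : (N < n.*2)%N.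
Variable nu0 : words beta.
Hypothesis nu0E : forall j, letter nu0 j = path_label n (depth j) :> nat.

(** All idempotents but that of the path word vanish, so that one equals 1; the other generators are
    zero, hence every generator is a scalar. *)
Lemma alg_const_surj (y : A) : exists c, y = alg_const c.
Proof.
have rels := cyc_pi_relations Q beta Lam.
have e0 nu : nu != nu0 -> cyc_pi Q Lam (idem_gen k nu) = 0.
  move=> ne; apply: (proj1 (vanishing hQ rels lt_N)); apply: contra ne => good.
  apply/eqP/val_inj/ffunP => j; apply: val_inj => /=.
  rewrite -/(letter nu j) -/(letter nu0 j) nu0E; apply: path_suffixP good _.
  by rewrite /depth; have := ltn_ord j; lia.
have e1 : cyc_pi Q Lam (idem_gen k nu0) = 1.
  by rewrite -(crel_sum_e rels) (bigD1 nu0) //= big1 ?addr0.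
elim/quot_ind: y; elim/quot_ind; elim/free_ind => [c|[[nu|j]|m]|y z|y z].
- by exists c; reflexivity.
- have [->|ne] := eqVneq nu nu0.
    by exists 1; rewrite rmorph1; exact: e1.
  by exists 0; rewrite rmorph0; exact: e0.
- by exists 0; rewrite rmorph0; exact: (x_eq0 hQ rels).
- by exists 0; rewrite rmorph0; exact: (tau_eq0 hQ rels).
- case=> c yc [d zd]; exists (c + d); rewrite rmorphD -yc -zd.
  exact: (rmorphD (cyc_pi Q Lam)).
case=> c yc [d zd]; exists (c * d); rewrite rmorphM -yc -zd.
exact: (rmorphM (cyc_pi Q Lam)).
Qed.

(** The character is a left inverse of [alg_const], which is surjective; hence the two are mutually
    inverse. *)
Lemma path_algebra_isomorphic : alg_isomorphic A k^o.
Proof.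
have [g [gC gE]] := free_lift_exists (path_value k nu0).
have [f fC] := path_character_exists n_ge2 hQ nu0E gC gE.
exists f; split=> //; exists (fun c : k => alg_const c : A) => y; last exact: fC.
by have [c ->] := alg_const_surj y; rewrite fC.
Qed.

End PathAlgebra.

Lemma path_word_exists (n : nat) (n_ge2 : (2 <= n)%N) (beta : root_cone 'I_n) :
    (height beta < n.*2)%N -> beta = path_root n_ge2 (height beta) ->
  exists nu : words beta,
    forall j, letter nu j = path_label n (depth j) :> nat.
Proof.
move=> lt_N betaE.
pose w := [ffun j : 'I_(height beta) => path_node n_ge2 (depth j)].
have wP : \sum_j simple (w j) == beta.
  (* Words are indexed from the left and the path from the right, so the sum is reversed. *)
  rewrite [X in _ == X]betaE /path_root [X in _ == X](reindex_inj rev_ord_inj).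
  apply/eqP; apply: eq_bigr => j _; rewrite ffunE; congr (simple (path_node _ _)).
  by rewrite /depth /=; have := ltn_ord j; lia.
exists (Sub w wP) => j; rewrite /letter SubK ffunE val_path_node //.
by rewrite /depth; have := ltn_ord j; lia.
Qed.

(** The algebra is attached to some beta with xi = Lambda_n - beta. The first conjunct says that
    such a beta exists, so that the second, which covers every choice of it, is not vacuous. *)
Theorem proposition2p11 (k : fieldType) (n : nat) (n_ge2 : (2 <= n)%N)
    (Q : 'I_n -> 'I_n -> {poly {poly k}})
    (hQ : quiver_hecke_polynomials (@cartanC n) (@symC n) Q)
    (Lam := fundamental_weight (last_node n_ge2))
    (b : minuscule_crystal (@cartanC n) Lam) :
  (exists beta : root_cone 'I_n, wt b = Lam - root_weight (@cartanC n) beta) /\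
  (forall beta : root_cone 'I_n, wt b = Lam - root_weight (@cartanC n) beta ->
     alg_isomorphic (cyclotomic_quiver_hecke Q beta Lam) k^o).
Proof.
have [t le_t bE] := weyl_orbit_path (svalP b).
have wtE : wt b = Lam - root_weight (@cartanC n) (path_root n_ge2 t).
  by rewrite -path_weightE.
split=> [|beta]; first by exists (path_root n_ge2 t).
(* Since beta is determined by its weight, it is the sum of the first [t] path letters and has
   height [t], which is less than [n.*2]. *)
rewrite wtE => /addrI/oppr_inj/(root_weight_inj n_ge2) betaE.
have ht : height beta = t by rewrite -betaE height_path_root.
have lt_N : (height beta < n.*2)%N by rewrite ht; lia.
have [|nu0 nu0E] := path_word_exists (n_ge2 := n_ge2) lt_N.
  by rewrite ht betaE.
exact: path_algebra_isomorphic nu0E.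
Qed.
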